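(* Suppose $\mathcal{C}$ is an abelian category with an allowable class $E$ with sectile epics, and suppose $\mathcal{C}$ has enough $E$-projectives. Then a map $f:X\to Y$ in $\mathcal{C}$ induces a natural isomorphism \[\mathrm{Ext}^1_{\mathcal{C}/E}(Y,-)\to\mathrm{Ext}^1_{\mathcal{C}/E}(X,-)\] if and only if there exist $E$-projective objects $P,Q$ and an isomorphism $g:X\oplus P\to Y\oplus Q$ such that the composite \[X\xrightarrow{i}X\oplus P\xrightarrow{g}Y\oplus Q\xrightarrow{p}Y\] is equal to $f$, where $i$ is the inclusion of the first summand and $p$ is the projection to the first summand.
   Context: An allowable class $E$ in an abelian category $\mathcal{C}$ is a collection of short exact sequences closed under isomorphism of short exact sequences and containing every short exact sequence in which at least one object is zero. An epimorphism $g: M\to N$ is an $E$-epimorphism (or $E$-epic) if $0\to\ker g\to M\to N\to 0$ is in $E$. An object $X$ is $E$-projective if every map $X\to N$ lifts through every $E$-epimorphism $M\to N$. $\mathcal{C}$ has enough $E$-projectives if every object $X$ admits an $E$-epimorphism $P\to X$ with $P$ $E$-projective. $E$ has sectile epics if, whenever $g\circ f$ is $E$-epic, $g$ is $E$-epic. $\mathrm{Ext}^n_{\mathcal{C}/E}(X,M)$ is the relative Ext group, i.e. the $n$th cohomology of $\mathrm{hom}_{\mathcal{C}}(P_\bullet,M)$, where $\dots\to P_1\xrightarrow{f_1}P_0\xrightarrow{f_0}X\to0$ is an exact sequence with all $P_i$ $E$-projective and each $0\to\ker f_i\to P_i\to\mathrm{im} f_i\to0$ in $E$; it is covariantly functorial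 in $M$ and contravariantly functorial in $X$. *)

(* Defs.v *)
From HB Require Import structures.
From mathcomp Require Import all_boot all_algebra ring_quotient.
From mathcomp Require Import boolp.
Set Implicit Arguments.
Unset Strict Implicit.
Unset Printing Implicit Defensive.
Import GRing.Theory.
Import ring_quotient.Quotient.Exports.
Local Open Scope ring_scope.
Local Open Scope quotient_scope.

Declare Scope cat_scope.
Delimit Scope cat_scope with cat.
Local Open Scope cat_scope.

Record preadditiveCat := PreadditiveCat {
  obj :> Type;
  Mor : obj -> obj -> zmodType;
  idmor : forall X, Mor X X;
  cmp : forall X Y Z, Mor Y Z -> Mor X Y -> Mor X Z;
  cmpA : forall X Y Z T (h : Mor Z T) (g : Mor Y Z) (f : Mor X Y),
    cmp h (cmp g f) = cmp (cmp h g) f;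
  cmp1m : forall X Y (f : Mor X Y), cmp (idmor Y) f = f;
  cmpm1 : forall X Y (f : Mor X Y), cmp f (idmor X) = f;
  cmpDl : forall X Y Z (g g' : Mor Y Z) (f : Mor X Y),
    cmp (g + g') f = cmp g f + cmp g' f;
  cmpDr : forall X Y Z (g : Mor Y Z) (f f' : Mor X Y),
    cmp g (f + f') = cmp g f + cmp g f' }.

Arguments Mor {p} _ _.
Arguments idmor {p} X.
Arguments cmp {p X Y Z} g f.
Notation "g ∘ f" := (cmp g f) (at level 40, left associativity) : cat_scope.

Section Preadditive.
Variable C : preadditiveCat.
Implicit Types X Y Z K T : C.

Definition is_zero X : Prop :=
  forall Y, (exists! f : Mor X Y, True) /\ (exists! f : Mor Y X, True).

Definition is_mono X Y (f : Mor X Y) : Prop :=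
  forall T (u v : Mor T X), f ∘ u = f ∘ v -> u = v.

Definition is_epi X Y (f : Mor X Y) : Prop :=
  forall T (u v : Mor Y T), u ∘ f = v ∘ f -> u = v.

Definition is_iso X Y (f : Mor X Y) : Prop :=
  exists g : Mor Y X, g ∘ f = idmor X /\ f ∘ g = idmor Y.

Definition is_kernel K X Y (k : Mor K X) (f : Mor X Y) : Prop :=
  f ∘ k = 0 /\
  forall T (h : Mor T X), f ∘ h = 0 -> exists! u : Mor T K, k ∘ u = h.

Definition is_cokernel X Y K (c : Mor Y K) (f : Mor X Y) : Prop :=
  c ∘ f = 0 /\
  forall T (h : Mor Y T), h ∘ f = 0 -> exists! u : Mor K T, u ∘ c = h.

Definition is_biproduct X Y S
    (i1 : Mor X S) (i2 : Mor Y S) (p1 : Mor S X) (p2 : Mor S Y) : Prop :=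
  [/\ p1 ∘ i1 = idmor X, p2 ∘ i2 = idmor Y, p2 ∘ i1 = 0, p1 ∘ i2 = 0
    & i1 ∘ p1 + i2 ∘ p2 = idmor S].

Definition short_exact X Y Z (i : Mor X Y) (p : Mor Y Z) : Prop :=
  is_kernel i p /\ is_cokernel p i.

End Preadditive.

Record abelianCat := AbelianCat {
  acat :> preadditiveCat;
  zob : acat;
  zobP : is_zero zob;
  biprod : acat -> acat -> acat;
  inj1 : forall X Y, Mor X (biprod X Y);
  inj2 : forall X Y, Mor Y (biprod X Y);
  prj1 : forall X Y, Mor (biprod X Y) X;
  prj2 : forall X Y, Mor (biprod X Y) Y;
  biprodP : forall X Y,
    is_biproduct (inj1 X Y) (inj2 X Y) (prj1 X Y) (prj2 X Y);
  kerob : forall X Y : acat, Mor X Y -> acat;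
  kerm : forall (X Y : acat) (f : Mor X Y), Mor (kerob f) X;
  kermP : forall (X Y : acat) (f : Mor X Y), is_kernel (kerm f) f;
  cokerob : forall X Y : acat, Mor X Y -> acat;
  cokerm : forall (X Y : acat) (f : Mor X Y), Mor Y (cokerob f);
  cokermP : forall (X Y : acat) (f : Mor X Y), is_cokernel (cokerm f) f;
  mono_kernel : forall (X Y : acat) (f : Mor X Y), is_mono f ->
    exists (Z : acat) (g : Mor Y Z), is_kernel f g;
  epi_cokernel : forall (X Y : acat) (f : Mor X Y), is_epi f ->
    exists (Z : acat) (g : Mor Z X), is_cokernel f g }.

Arguments inj1 {a} X Y.
Arguments inj2 {a} X Y.
Arguments prj1 {a} X Y.
Arguments prj2 {a} X Y.
Notation "X ⊕ Y" := (biprod X Y) (at level 50, left associativity) : cat_scope.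

Section PreadditiveTheory.
Variable C : preadditiveCat.
Implicit Types X Y Z K T : C.

Lemma cmp0m X Y Z (f : Mor X Y) : (0 : Mor Y Z) ∘ f = 0.
Proof. by apply: (addrI (0 ∘ f)); rewrite -cmpDl !addr0. Qed.

Lemma cmpm0 X Y Z (g : Mor Y Z) : g ∘ (0 : Mor X Y) = 0.
Proof. by apply: (addrI (g ∘ 0)); rewrite -cmpDr !addr0. Qed.

Lemma cmpBl X Y Z (g g' : Mor Y Z) (f : Mor X Y) :
  (g - g') ∘ f = g ∘ f - g' ∘ f.
Proof. by apply/eqP; rewrite eq_sym subr_eq -cmpDl subrK. Qed.

Lemma cmpBr X Y Z (g : Mor Y Z) (f f' : Mor X Y) :
  g ∘ (f - f') = g ∘ f - g ∘ f'.
Proof. by apply/eqP; rewrite eq_sym subr_eq -cmpDr subrK. Qed.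

Lemma kernel_mono K X Y (k : Mor K X) (f : Mor X Y) : is_kernel k f -> is_mono k.
Proof.
move=> [fk0 kU] T u v kuv.
have [|w [_ wU]] := kU T (k ∘ u); first by rewrite cmpA fk0 cmp0m.
by rewrite -(wU u) // -(wU v).
Qed.

Lemma cokernel_epi X Y K (c : Mor Y K) (f : Mor X Y) : is_cokernel c f -> is_epi c.
Proof.
move=> [cf0 cU] T u v cuv.
have [|w [_ wU]] := cU T (u ∘ c); first by rewrite -cmpA cf0 cmpm0.
by rewrite -(wU u) // -(wU v).
Qed.

Lemma kernel_iso K K' X Y Z (k : Mor K X) (k' : Mor K' X)
    (f : Mor X Y) (g : Mor X Z) :
    is_kernel k f -> is_kernel k' g -> g ∘ k = 0 -> f ∘ k' = 0 ->
  exists u : Mor K K', is_iso u /\ k' ∘ u = k.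
Proof.
move=> kP kP' gk fk'.
have [u [uE _]] := kP'.2 _ _ gk; have [v [vE _]] := kP.2 _ _ fk'.
exists u; split=> //; exists v; split.
  by apply: (kernel_mono kP); rewrite cmpA vE uE cmpm1.
by apply: (kernel_mono kP'); rewrite cmpA uE vE cmpm1.
Qed.

Lemma kernel_epi_exact X Y Z T (i : Mor X Y) (p : Mor Y Z) (g : Mor T Y) :
  is_kernel i p -> is_cokernel p g -> short_exact i p.
Proof.
move=> iP pP; split=> //; split=> [|S h hi0]; first exact: iP.1.
have [w [wE _]] := iP.2 _ _ pP.1.
by apply: pP.2; rewrite -wE cmpA hi0 cmp0m.
Qed.

End PreadditiveTheory.

Section AbelianTheory.
Variable C : abelianCat.
Implicit Types X Y Z K T : C.

Definition ker_lift X Y T (f : Mor X Y) (h : Mor T X) (fh : f ∘ h = 0) :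
    Mor T (kerob f) :=
  projT1 (cid ((kermP f).2 T h fh)).

Lemma ker_liftE X Y T (f : Mor X Y) (h : Mor T X) (fh : f ∘ h = 0) :
  kerm f ∘ ker_lift fh = h.
Proof. by rewrite /ker_lift; case: cid => u []. Qed.

Definition im X Y (f : Mor X Y) : C := kerob (cokerm f).
Definition imm X Y (f : Mor X Y) : Mor (im f) Y := kerm (cokerm f).
Definition toim X Y (f : Mor X Y) : Mor X (im f) := ker_lift (cokermP f).1.

Lemma toimE X Y (f : Mor X Y) : imm f ∘ toim f = f.
Proof. exact: ker_liftE. Qed.

(* Exactness of X -> Y -> Z at Y: im f and ker g are the same subobject. *)
Definition exact X Y Z (f : Mor X Y) (g : Mor Y Z) : Prop :=
  exists u : Mor (im f) (kerob g), is_iso u /\ kerm g ∘ u = imm f.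

Lemma exact_comp0 X Y Z (f : Mor X Y) (g : Mor Y Z) : exact f g -> g ∘ f = 0.
Proof.
by move=> [u [_ uE]]; rewrite -(toimE f) -uE !cmpA (kermP g).1 !cmp0m.
Qed.

Lemma epi_kernel_exact X Y Z (i : Mor X Y) (p : Mor Y Z) :
  is_kernel i p -> is_epi p -> short_exact i p.
Proof.
by move=> iP /epi_cokernel [T [g pP]]; apply: kernel_epi_exact pP.
Qed.

Lemma mono_im X K Y (k : Mor K Y) (e : Mor X K) : is_mono k -> is_epi e ->
  is_kernel k (cokerm (k ∘ e)).
Proof.
move=> /mono_kernel [Z [g gP]] eE; split=> [|T h h0].
  by apply: eE; rewrite -cmpA (cokermP (k ∘ e)).1 cmp0m.
apply: gP.2.
have [|w [wE _]] := (cokermP (k ∘ e)).2 _ g; first by rewrite cmpA gP.1 cmp0m.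
by rewrite -wE -cmpA h0 cmpm0.
Qed.

End AbelianTheory.

Record allowable (C : abelianCat) := Allowable {
  in_class : forall X Y Z : C, Mor X Y -> Mor Y Z -> Prop;
  acl_exact : forall (X Y Z : C) (i : Mor X Y) (p : Mor Y Z),
    in_class i p -> short_exact i p;
  acl_iso : forall (X Y Z X' Y' Z' : C) (i : Mor X Y) (p : Mor Y Z)
      (i' : Mor X' Y') (p' : Mor Y' Z')
      (a : Mor X X') (b : Mor Y Y') (c : Mor Z Z'),
    short_exact i p -> short_exact i' p' ->
    is_iso a -> is_iso b -> is_iso c -> i' ∘ a = b ∘ i -> p' ∘ b = c ∘ p ->
    in_class i p -> in_class i' p';
  acl_zero : forall (X Y Z : C) (i : Mor X Y) (p : Mor Y Z),
    short_exact i p -> [\/ is_zero X, is_zero Y | is_zero Z] -> in_class i p }.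

Section Relative.
Variables (C : abelianCat) (E : allowable C).
Implicit Types X Y Z K T M N : C.

Definition Eepi X Y (g : Mor X Y) : Prop := is_epi g /\ in_class E (kerm g) g.

Definition Eprojective P : Prop :=
  forall (M N : C) (g : Mor M N), Eepi g ->
  forall h : Mor P N, exists h' : Mor P M, g ∘ h' = h.

Definition enough_Eprojectives : Prop :=
  forall X, exists (P : C) (g : Mor P X), Eprojective P /\ Eepi g.

Definition sectile_epics : Prop :=
  forall X Y Z (g : Mor Y Z) (f : Mor X Y), Eepi (g ∘ f) -> Eepi g.

(* aug P X is the sequence X, P 0, P 1, ... ; the n-th map of a resolution is
   then [P n -> aug P X n]. *)
Definition aug (P : nat -> C) X (n : nat) : C :=
  if n is m.+1 then P m else X.

Record resolution X := Resolution {
  rob :> nat -> C;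
  rmap : forall n, Mor (rob n) (aug rob X n);
  rmap0_epi : is_epi (rmap 0);
  rmap_exact : forall n, exact (rmap n.+1) (rmap n);
  rob_proj : forall n, Eprojective (rob n);
  rmap_E : forall n, in_class E (kerm (rmap n)) (toim (rmap n)) }.

Lemma is_iso_id X : is_iso (idmor X).
Proof. by exists (idmor X); rewrite cmp1m. Qed.

Lemma Eepi_kernel K X Y (k : Mor K X) (p : Mor X Y) : in_class E k p -> Eepi p.
Proof.
move=> Ekp; have kp := acl_exact Ekp.
have pE := cokernel_epi kp.2; split=> //.
have [u [uI uE]] := kernel_iso kp.1 (kermP p) kp.1.1 (kermP p).1.
apply: (acl_iso kp _ uI (is_iso_id X) (is_iso_id Y)) Ekp => //.
- exact: epi_kernel_exact (kermP p) pE.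
- by rewrite uE cmp1m.
- by rewrite cmpm1 cmp1m.
Qed.

Lemma mono_Eepi_toim X K Y (k : Mor K Y) (e : Mor X K) :
  is_mono k -> Eepi e -> in_class E (kerm (k ∘ e)) (toim (k ∘ e)).
Proof.
move=> kM [eE Ee]; set f := k ∘ e.
have kP := mono_im kM eE.
have [v [vI vE]] := kernel_iso kP (kermP _) kP.1 (kermP _).1.
have mM : is_mono (imm f) := kernel_mono (kermP _).
have tE : v ∘ e = toim f by apply: mM; rewrite toimE cmpA /imm vE.
have fk0 : f ∘ kerm e = 0 by rewrite -cmpA (kermP e).1 cmpm0.
have ek0 : e ∘ kerm f = 0 by apply: kM; rewrite cmpA (kermP f).1 cmpm0.
have [a [aI aE]] := kernel_iso (kermP e) (kermP f) fk0 ek0.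
apply: (acl_iso (acl_exact Ee) _ aI (is_iso_id X) vI) Ee.
- apply: epi_kernel_exact.
    split=> [|T h h0]; first by rewrite -tE -cmpA ek0 cmpm0.
    by apply: (kermP f).2; rewrite -(toimE f) -cmpA h0 cmpm0.
  case: vI => w [wv vw] T r s; rewrite -tE !cmpA => /eE rs.
  by rewrite -(cmpm1 r) -(cmpm1 s) -vw !cmpA rs.
- by rewrite aE cmp1m.
- by rewrite cmpm1 tE.
Qed.

(* The last object reached by a partial resolution, with the subobject of it
   that the next object has to cover. *)
Record syzygy := Syzygy {
  sz_ob : C;
  sz_ker : C;
  sz_m : Mor sz_ker sz_ob;
  sz_mono : is_mono sz_m }.

Record Ecover X := MkEcover {
  cov_ob : C;
  cov_m : Mor cov_ob X;
  cov_proj : Eprojective cov_ob;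
  cov_epi : Eepi cov_m }.

Lemma enough_Ecover (hE : enough_Eprojectives) X : Ecover X.
Proof.
by have [P /cid [g [Pp gE]]] := cid (hE X); exact: MkEcover Pp gE.
Qed.

Section Construction.
Hypothesis hE : enough_Eprojectives.

Definition sz_map (s : syzygy) : Mor (cov_ob (enough_Ecover hE (sz_ker s))) (sz_ob s) :=
  sz_m s ∘ cov_m (enough_Ecover hE (sz_ker s)).

Definition sz_next (s : syzygy) : syzygy :=
  Syzygy (kernel_mono (kermP (sz_map s))).

Lemma idmor_mono X : is_mono (idmor X).
Proof. by move=> T u v; rewrite !cmp1m. Qed.

Definition sz X (n : nat) : syzygy := iter n sz_next (Syzygy (@idmor_mono X)).

Definition res_ob X (n : nat) : C := cov_ob (enough_Ecover hE (sz_ker (sz X n))).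

Definition res_map X (n : nat) : Mor (res_ob X n) (aug (res_ob X) X n) :=
  match n with
  | 0 => sz_map (sz X 0)
  | m.+1 => sz_map (sz X m.+1)
  end.

Lemma res_map0_epi X : is_epi (res_map X 0).
Proof.
rewrite /= /sz_map /= cmp1m.
by have [] := cov_epi (enough_Ecover hE X).
Qed.

Lemma sz_exact s : exact (sz_map (sz_next s)) (sz_map s).
Proof.
have [eE _] := cov_epi (enough_Ecover hE (sz_ker (sz_next s))).
have kP := mono_im (sz_mono (s := sz_next s)) eE.
exact: kernel_iso (kermP _) kP (kermP _).1 kP.1.
Qed.

Lemma sz_E s : in_class E (kerm (sz_map s)) (toim (sz_map s)).
Proof.
exact: mono_Eepi_toim (sz_mono (s := s)) (cov_epi (enough_Ecover hE (sz_ker s))).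
Qed.

Lemma res_exact X n : exact (res_map X n.+1) (res_map X n).
Proof. by case: n => [|n]; exact: sz_exact. Qed.

Lemma res_proj X n : Eprojective (res_ob X n).
Proof. exact: cov_proj. Qed.

Lemma res_E X n : in_class E (kerm (res_map X n)) (toim (res_map X n)).
Proof. by case: n => [|n]; exact: sz_E. Qed.

Definition res X : resolution X :=
  Resolution (@res_map0_epi X) (@res_exact X) (@res_proj X) (@res_E X).

End Construction.

Section Comparison.
Variables (X Y : C) (P : resolution X) (Q : resolution Y).

Definition aug_map (f : Mor X Y) (phi : forall n, Mor (P n) (Q n)) (n : nat) :
    Mor (aug P X n) (aug Q Y n) :=
  if n is m.+1 then phi m else f.

Definition lifts (f : Mor X Y) (phi : forall n, Mor (P n) (Q n)) : Prop :=
  forall n, rmap Q n ∘ phi n = aug_map f phi n ∘ rmap P n.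

Lemma rmap_comp0 n : rmap Q n ∘ rmap Q n.+1 = 0.
Proof. exact: exact_comp0 (rmap_exact Q n). Qed.

Lemma Eproj_lift0 T (h : Mor T Y) : Eprojective T ->
  exists h' : Mor T (Q 0), rmap Q 0 ∘ h' = h.
Proof.
move=> Tp; have c0 : cokerm (rmap Q 0) ∘ h = 0.
  suff -> : cokerm (rmap Q 0) = 0 by rewrite cmp0m.
  by apply: (rmap0_epi (r := Q)); rewrite (cokermP _).1 cmp0m.
have [h' hE] := Tp _ _ _ (Eepi_kernel (rmap_E Q 0)) (ker_lift c0).
by exists h'; rewrite -{1}(toimE (rmap Q 0)) -cmpA hE ker_liftE.
Qed.

Lemma Eproj_liftS n T (h : Mor T (Q n)) : Eprojective T -> rmap Q n ∘ h = 0 ->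
  exists h' : Mor T (Q n.+1), rmap Q n.+1 ∘ h' = h.
Proof.
move=> Tp h0; have [u [[v [vu uv]] uE]] := rmap_exact Q n.
have [h' hE] := Tp _ _ _ (Eepi_kernel (rmap_E Q n.+1)) (v ∘ ker_lift h0).
exists h'; rewrite -{1}(toimE (rmap Q n.+1)) -cmpA hE -uE.
by rewrite -cmpA (cmpA u) uv cmp1m ker_liftE.
Qed.

Lemma lifts_exist (f : Mor X Y) : exists phi, lifts f phi.
Proof.
pose sq n := {p : Mor (aug P X n) (aug Q Y n) * Mor (P n) (Q n) |
  rmap Q n ∘ p.2 = p.1 ∘ rmap P n}.
have sq0 : {s : sq 0 | (sval s).1 = f}.
  have [v vE] := cid (Eproj_lift0 (f ∘ rmap P 0) (@rob_proj _ P 0)).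
  by exists (exist _ (f, v) vE).
have sqS n (s : sq n) : {t : sq n.+1 | (sval t).1 = (sval s).2}.
  case: s => [[u v] /= uvE].
  have [|w wE] := cid (Eproj_liftS (h := v ∘ rmap P n.+1) (@rob_proj _ P n.+1) _).
    by rewrite cmpA uvE -cmpA (exact_comp0 (rmap_exact P n)) cmpm0.
  by exists (exist _ (v, w) wE).
pose F := fix F n : sq n := if n is m.+1 then sval (sqS m (F m)) else sval sq0.
exists (fun n => (sval (F n)).2) => -[|n] /=; rewrite (svalP (F _)) /=.
  by rewrite (svalP sq0).
by rewrite (svalP (sqS n (F n))).
Qed.

Definition chain_lift (f : Mor X Y) : forall n, Mor (P n) (Q n) :=
  projT1 (cid (lifts_exist f)).

Lemma chain_liftP f : lifts f (chain_lift f).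
Proof. by rewrite /chain_lift; case: cid. Qed.

(* Two lifts of the same map are chain homotopic; [s] is the homotopy. *)
Lemma lifts_homotopic f phi psi n : lifts f phi -> lifts f psi ->
  exists2 s : Mor (aug P X n) (Q n), (n = 0%N -> s = 0) &
  exists t : Mor (P n) (Q n.+1),
    phi n - psi n = rmap Q n.+1 ∘ t + s ∘ rmap P n.
Proof.
move=> phiE psiE; elim: n => [|n [s _ [t tE]]].
  exists 0 => //; have [|t tE] := Eproj_liftS (h := phi 0 - psi 0) (@rob_proj _ P 0) _.
    by rewrite cmpBr phiE psiE subrr.
  by exists t; rewrite tE cmp0m addr0.
exists t => //.
have [|w wE] := Eproj_liftS
  (h := phi n.+1 - psi n.+1 - t ∘ rmap P n.+1) (@rob_proj _ P n.+1) _.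
  rewrite !cmpBr phiE psiE /= -cmpBl tE cmpDl -!cmpA.
  by rewrite (exact_comp0 (rmap_exact P n)) cmpm0 addr0 subrr.
by exists w; rewrite wE subrK.
Qed.

End Comparison.

End Relative.

Section Composition.
Variables (C : preadditiveCat) (X Y Z : C).

Definition postcomp (g : Mor Y Z) (f : Mor X Y) : Mor X Z := g ∘ f.
Definition precomp (f : Mor X Y) (g : Mor Y Z) : Mor X Z := g ∘ f.

Lemma postcomp_additive g : zmod_morphism (postcomp g).
Proof. by move=> f f'; exact: cmpBr. Qed.

Lemma precomp_additive f : zmod_morphism (precomp f).
Proof. by move=> g g'; exact: cmpBl. Qed.

HB.instance Definition _ g :=
  GRing.isZmodMorphism.Build (Mor X Y) (Mor X Z) (postcomp g) (postcomp_additive g).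
HB.instance Definition _ f :=
  GRing.isZmodMorphism.Build (Mor Y Z) (Mor X Z) (precomp f) (precomp_additive f).

End Composition.

Section Cohomology.
Variables (C : abelianCat) (E : allowable C) (X : C) (P : resolution E X).
Variables (n : nat) (M : C).

Definition cocycle : {pred Mor (P n) M} := fun c => c ∘ rmap P n.+1 == 0.

Lemma cocycle_closed : zmod_closed cocycle.
Proof.
split=> [|c c']; rewrite !unfold_in /cocycle ?cmp0m //.
by move=> /eqP c0 /eqP c'0; rewrite cmpBl c0 c'0 subrr.
Qed.
HB.instance Definition _ :=
  GRing.isZmodClosed.Build (Mor (P n) M) cocycle cocycle_closed.

Record cocycles := Cocycle { cochain : Mor (P n) M; _ : cochain \in cocycle }.
HB.instance Definition _ := [isSub for cochain].
HB.instance Definition _ := [Choice of cocycles by <:].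
HB.instance Definition _ := [SubChoice_isSubZmodule of cocycles by <:].

End Cohomology.

Arguments cocycle {C E X} P n M _.

Section Coboundary.
Variables (C : abelianCat) (E : allowable C) (X : C) (P : resolution E X).

(* The complex hom(P_0, M) -> hom(P_1, M) -> ... starts in degree 0: the only
   coboundary there is 0, the augmentation P_0 -> X being left out. *)
Definition is_coboundary (n : nat) (M : C) : Mor (P n) M -> Prop :=
  match n with
  | 0 => fun c => c = 0
  | m.+1 => fun c => exists b : Mor (P m) M, c = b ∘ rmap P m.+1
  end.

Variables (n : nat) (M : C).

Definition coboundary : {pred cocycles P n M} :=
  fun c => `[< is_coboundary (cochain c) >].

Lemma is_coboundaryB (c c' : Mor (P n) M) :
  is_coboundary c -> is_coboundary c' -> is_coboundary (c - c').
Proof.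
case: n c c' => [|m] c c' /= => [-> ->|[b ->] [b' ->]]; first by rewrite subrr.
by exists (b - b'); rewrite cmpBl.
Qed.

Lemma coboundary_closed : zmod_closed coboundary.
Proof.
split=> [|c c']; rewrite !unfold_in /coboundary.
  apply/asboolP; rewrite -[cochain 0]/(val (0 : cocycles P n M)) raddf0.
  by case: n => [//|m]; exists 0; rewrite cmp0m.
move=> /asboolP cB /asboolP cB'; apply/asboolP.
by rewrite -[cochain _]/(val (c - c')) raddfB; exact: is_coboundaryB.
Qed.
HB.instance Definition _ :=
  GRing.isZmodClosed.Build (cocycles P n M) coboundary coboundary_closed.

Definition cohomology : zmodType := Quotient.quot coboundary.

Definition cohom_class (c : cocycles P n M) : cohomology :=
  \pi_(Quotient.quot coboundary) c.

End Coboundary.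

Section CohomClass.
Variables (C : abelianCat) (E : allowable C) (X : C) (P : resolution E X).
Variables (n : nat) (M : C).

Lemma cohom_classP (c c' : cocycles P n M) :
  cohom_class c = cohom_class c' <-> is_coboundary (cochain c - cochain c').
Proof.
have -> : cochain c - cochain c' = cochain (c - c') by [].
split=> [/eqP|cB]; last apply/eqP; rewrite -Quotient.idealrBE unfold_in.
  by move=> /asboolP.
exact/asboolP.
Qed.

Lemma cohom_class_additive : zmod_morphism (@cohom_class C E X P n M).
Proof. by move=> c c'; rewrite /cohom_class raddfB. Qed.
HB.instance Definition _ := GRing.isZmodMorphism.Build
  (cocycles P n M) (cohomology P n M) (@cohom_class C E X P n M)
  cohom_class_additive.

Lemma cohom_class_repr (x : cohomology P n M) : cohom_class (repr x) = x.
Proof. exact: reprK. Qed.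

End CohomClass.

Section Induced.
Variables (C : abelianCat) (E : allowable C) (X X' : C).
Variables (P : resolution E X) (P' : resolution E X') (n : nat) (M M' : C).

Record cochain_map := CochainMap {
  cmap :> {additive Mor (P n) M -> Mor (P' n) M'};
  cmapZ : forall c, c \in cocycle P n M -> cmap c \in cocycle P' n M';
  cmapB : forall c, is_coboundary c -> is_coboundary (cmap c) }.

Variable t : cochain_map.

Definition cocycle_map (c : cocycles P n M) : cocycles P' n M' :=
  Cocycle (cmapZ t (valP c)).

Definition cohom_map (x : cohomology P n M) : cohomology P' n M' :=
  cohom_class (cocycle_map (repr x)).

Lemma cohom_mapE c : cohom_map (cohom_class c) = cohom_class (cocycle_map c).
Proof.
apply/cohom_classP => /=; rewrite -raddfB; apply: cmapB; apply/cohom_classP.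
exact: cohom_class_repr.
Qed.

Lemma cohom_map_additive : zmod_morphism cohom_map.
Proof.
move=> x y; rewrite -(cohom_class_repr x) -(cohom_class_repr y).
rewrite -raddfB !cohom_mapE -raddfB; congr cohom_class; apply: val_inj.
exact: (raddfB t).
Qed.
HB.instance Definition _ := GRing.isZmodMorphism.Build
  (cohomology P n M) (cohomology P' n M') cohom_map cohom_map_additive.

End Induced.

Record abFunctor (C : preadditiveCat) := AbFunctor {
  fob :> C -> zmodType;
  fmap : forall M N : C, Mor M N -> {additive fob M -> fob N};
  fmap_id : forall (M : C) (x : fob M), fmap (idmor M) x = x;
  fmap_comp : forall (M N L : C) (g : Mor N L) (f : Mor M N) (x : fob M),
    fmap (g ∘ f) x = fmap g (fmap f x) }.

Record natTrans (C : preadditiveCat) (F G : abFunctor C) := NatTrans {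
  ntmap :> forall M : C, {additive F M -> G M};
  ntmap_nat : forall (M N : C) (f : Mor M N) (x : F M),
    ntmap N (fmap F f x) = fmap G f (ntmap M x) }.

Definition is_natiso (C : preadditiveCat) (F G : abFunctor C)
    (eta : natTrans F G) : Prop :=
  exists theta : natTrans G F, forall M : C,
    cancel (eta M) (theta M) /\ cancel (theta M) (eta M).

Section CovariantMap.
Variables (C : abelianCat) (E : allowable C) (X : C) (P : resolution E X).
Variables (n : nat) (M N : C) (g : Mor M N).

Lemma postcompZ c : c \in cocycle P n M -> postcomp g c \in cocycle P n N.
Proof.
rewrite !unfold_in /cocycle /postcomp => /eqP c0.
by rewrite -cmpA c0 cmpm0.
Qed.

Lemma postcompB (c : Mor (P n) M) :
  is_coboundary c -> is_coboundary (P := P) (postcomp g c).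
Proof.
rewrite /postcomp; case: n c => [|m] c /= => [->|[b ->]]; first by rewrite cmpm0.
by exists (g ∘ b); rewrite cmpA.
Qed.

Definition postcomp_cmap : cochain_map P P n M N := CochainMap postcompZ postcompB.

End CovariantMap.

Section ContravariantMap.
Variables (C : abelianCat) (E : allowable C) (X Y : C) (f : Mor X Y).
Variables (P : resolution E X) (Q : resolution E Y) (n : nat) (M : C).
Variables (phi : forall m, Mor (P m) (Q m)) (phiE : lifts f phi).

Lemma precompZ c : c \in cocycle Q n M -> precomp (phi n) c \in cocycle P n M.
Proof.
rewrite !unfold_in /cocycle /precomp => /eqP c0.
by rewrite -cmpA -(phiE n.+1) cmpA c0 cmp0m.
Qed.

Lemma precompB (c : Mor (Q n) M) :
  is_coboundary c -> is_coboundary (P := P) (precomp (phi n) c).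
Proof.
rewrite /precomp; case: n c => [|m] c /= => [->|[b ->]]; first by rewrite cmp0m.
by exists (b ∘ phi m); rewrite -cmpA (phiE m.+1) cmpA.
Qed.

Definition precomp_cmap : cochain_map Q P n M M := CochainMap precompZ precompB.

End ContravariantMap.

Section Ext.
Variables (C : abelianCat) (E : allowable C) (hE : enough_Eprojectives E).
Variable n : nat.

(* Computed from one fixed resolution of X, [res hE X], picked by choice. *)
Definition Ext (X M : C) : zmodType := cohomology (res hE X) n M.

Definition Ext_post (X M N : C) (g : Mor M N) : {additive Ext X M -> Ext X N} :=
  cohom_map (postcomp_cmap (res hE X) n g).

Lemma Ext_post_id X M (x : Ext X M) : Ext_post X (idmor M) x = x.
Proof.
rewrite -(cohom_class_repr x) [LHS]cohom_mapE; congr cohom_class.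
by apply: val_inj; exact: cmp1m.
Qed.

Lemma Ext_post_comp X M N L (g : Mor N L) (f : Mor M N) (x : Ext X M) :
  Ext_post X (g ∘ f) x = Ext_post X g (Ext_post X f x).
Proof.
rewrite -(cohom_class_repr x) [LHS]cohom_mapE.
rewrite [Ext_post X f _]cohom_mapE [RHS]cohom_mapE; congr cohom_class.
by apply: val_inj; rewrite /= /postcomp cmpA.
Qed.

Definition ExtF (X : C) : abFunctor C :=
  AbFunctor (@Ext_post_id X) (@Ext_post_comp X).

Section Pullback.
Variables (X Y : C) (f : Mor X Y).

Definition Ext_pre (M : C) : {additive Ext Y M -> Ext X M} :=
  cohom_map (precomp_cmap n M (chain_liftP (res hE X) (res hE Y) f)).

Lemma Ext_pre_nat M N (g : Mor M N) (x : ExtF Y M) :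
  Ext_pre N (fmap (ExtF Y) g x) = fmap (ExtF X) g (Ext_pre M x).
Proof.
rewrite -(cohom_class_repr x) [fmap _ g _]cohom_mapE [LHS]cohom_mapE.
rewrite [Ext_pre M _]cohom_mapE [RHS]cohom_mapE; congr cohom_class.
by apply: val_inj; rewrite /= /precomp /postcomp cmpA.
Qed.

Definition ExtT : natTrans (ExtF Y) (ExtF X) :=
  @NatTrans C (ExtF Y) (ExtF X) Ext_pre Ext_pre_nat.

(* The induced map does not depend on the chosen lift of f. *)
Lemma Ext_preE phi (phiE : lifts f phi) M (c : cocycles (res hE Y) n M) :
  Ext_pre M (cohom_class c) =
  cohom_class (cocycle_map (precomp_cmap n M phiE) c).
Proof.
rewrite [LHS]cohom_mapE; apply/cohom_classP => /=.
rewrite /precomp -cmpBr.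
have [s s0 [t ->]] := lifts_homotopic n (chain_liftP _ _ f) phiE.
case: c => c /=; rewrite unfold_in /cocycle => /eqP c0.
rewrite cmpDr cmpA c0 cmp0m add0r.
move: c c0 s s0 t; case: n => [|m] c _ s s0 _ /=.
  by rewrite s0 // cmp0m cmpm0.
by exists (c ∘ s); rewrite cmpA.
Qed.

End Pullback.
End Ext.

(* Main.v *)
Require Import Defs.
From mathcomp Require Import all_boot.
From mathcomp Require Import all_algebra.
Set Implicit Arguments.
Unset Strict Implicit.
Unset Printing Implicit Defensive.
Import GRing.Theory.
Local Open Scope ring_scope.
Local Open Scope cat_scope.

(** Ext^n(-, M), for n > 0, is an additive contravariant functor that kills
    every map factoring through an E-projective, so it only sees maps modulo
    such maps (the stable category).

    If [f] is a summand of an isomorphism X ⊕ P -> Y ⊕ Q as in the theorem, then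
    the corresponding component f' : Y -> X of the inverse isomorphism is inverse
    to [f] up to maps through P and Q ([component_retraction]); hence f' induces
    the inverse of the map that [f] induces.

    For the converse, an E-epimorphism p : B -> T has a class in
    Ext^1(T, ker p), and the pullback of this class along u : S -> T is the
    obstruction to lifting u through p ([Ext1_obstruction]).  Let q : P -> Y be
    an E-epimorphism from an E-projective, and let π = (f, q) : X ⊕ P -> Y, which
    is an E-epimorphism because epics are sectile.  As [f] lifts through π, it
    kills the class of π; since [f] is injective on Ext^1, this class is 0 and π
    splits, so that X ⊕ P is Y ⊕ K with K = ker π.  It remains to see that K is
    E-projective.  Let w : W -> K be an E-epimorphism from an E-projective, with
    class ξ, and let r : X ⊕ P -> K be the projection.  Modulo E-projectives
    X ⊕ P is X and π is [f], so surjectivity of [f] on Ext^1 gives η with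
    r^* ξ = π^* η.  Restricting to the summand Y of X ⊕ P gives η = 0, and then
    restricting to the summand K gives ξ = 0.  Hence w splits, and K is a retract
    of W. *)

(** * Resolutions and lifts of maps *)

(** A resolution presents its object as the cokernel of its first map, so a map
    out of P_0 that kills the image of P_1 descends to X. *)
Lemma resolution_descend (C : abelianCat) (E : allowable C) (X : C)
    (P : resolution E X) (T : C) (h : Mor (P 0%N) T) :
  h ∘ rmap P 1 = 0 -> exists h' : Mor X T, h' ∘ rmap P 0 = h.
Proof.
move=> h0; have [u [[v [vu uv]] uE]] := rmap_exact P 0.
have [toimE _] := Eepi_kernel (rmap_E P 1).
have him0 : h ∘ imm (rmap P 1) = 0.
  by apply: toimE; rewrite -cmpA Defs.toimE h0 cmp0m.
have hk0 : h ∘ kerm (rmap P 0) = 0.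
  by rewrite -[kerm _]cmpm1 -uv (cmpA _ u) uE cmpA him0 cmp0m.
have [_ dP] := epi_kernel_exact (kermP _) (rmap0_epi (r := P)).
by have [h' [h'E _]] := dP.2 _ _ hk0; exists h'.
Qed.

Section Lifts.
Variables (C : abelianCat) (E : allowable C) (X Y Z : C).
Variables (P : resolution E X) (Q : resolution E Y) (R : resolution E Z).

Lemma lifts_id : lifts (idmor X) (fun n => idmor (P n)).
Proof. by case=> [|n] /=; rewrite cmp1m cmpm1. Qed.

Lemma lifts_comp (f : Mor X Y) (g : Mor Y Z)
    (phi : forall n, Mor (P n) (Q n)) (psi : forall n, Mor (Q n) (R n)) :
  lifts f phi -> lifts g psi -> lifts (g ∘ f) (fun n => psi n ∘ phi n).
Proof.
move=> phiE psiE n; rewrite cmpA psiE -cmpA phiE cmpA.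
by case: n.
Qed.

Lemma liftsB (f g : Mor X Y) (phi psi : forall n, Mor (P n) (Q n)) :
  lifts f phi -> lifts g psi -> lifts (f - g) (fun n => phi n - psi n).
Proof.
move=> phiE psiE n; rewrite cmpBr phiE psiE -cmpBl.
by case: n.
Qed.

(** A map through an E-projective has a lift concentrated in degree 0: lift the
    second factor to Q_0; the composite then factors through the augmentation
    of P, so it kills the image of P_1. *)
Lemma lifts_through_projective (T : C) (w : Mor X T) (v : Mor T Y) :
  Eprojective E T ->
  exists2 phi : forall n, Mor (P n) (Q n),
    lifts (v ∘ w) phi & forall n, phi n.+1 = 0.
Proof.
move=> Tp; have [v' v'E] := Eproj_lift0 Q v Tp.
pose phi n : Mor (P n) (Q n) :=
  if n is 0 then v' ∘ (w ∘ rmap P 0) else 0.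
exists phi => // -[|[|n]] /=.
- by rewrite (cmpA (rmap Q 0)) v'E cmpA.
- by rewrite -!cmpA (exact_comp0 (rmap_exact P 0)) !cmpm0.
- by rewrite cmpm0 cmp0m.
Qed.

End Lifts.

(** * The class of an E-epimorphism *)

(** The cocycle is the connecting one for 0 -> ker p -> B -> T -> 0: lift the
    augmentation of R to a : R_0 -> B, and restrict a to the image of R_1, where
    it lands in the kernel of p.  For u with lift φ, the pulled-back cocycle is
    the restriction of a φ_0; it is a coboundary exactly when a φ_0 can be
    corrected by a map into the kernel so as to descend to S, and the maps
    S -> B obtained in this way are the lifts of u. *)
Lemma obstruction_cocycle (C : abelianCat) (E : allowable C) (B T : C)
    (R : resolution E T) (p : Mor B T) : Eepi E p ->
  exists2 c : Mor (R 1%N) (kerob p), c \in cocycle R 1 (kerob p) &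
  forall S (P : resolution E S) (u : Mor S T)
      (phi : forall n, Mor (P n) (R n)), lifts u phi ->
    is_coboundary (P := P) (n := 1) (c ∘ phi 1%N)
    <-> exists u' : Mor S B, p ∘ u' = u.
Proof.
move=> pE; have [a aE] := @rob_proj _ _ _ R 0%N _ _ p pE (rmap R 0).
have [|c [cE _]] := (kermP p).2 _ (a ∘ rmap R 1).
  by rewrite cmpA aE (exact_comp0 (rmap_exact R 0)).
exists c => [|S P u phi uP].
  rewrite unfold_in /cocycle; apply/eqP; apply: (kernel_mono (kermP p)).
  by rewrite cmpA cE -cmpA (exact_comp0 (rmap_exact R 1)) !cmpm0.
have kcE : kerm p ∘ (c ∘ phi 1%N) = a ∘ phi 0%N ∘ rmap P 1.
  by rewrite cmpA cE -!cmpA (uP 1%N).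
split=> [[b cb]|[u' u'E]].
  have [|u' u'E] := @resolution_descend _ _ _ P _ (a ∘ phi 0%N - kerm p ∘ b).
    by rewrite cmpBl -kcE -cmpA cb subrr.
  exists u'; apply: (rmap0_epi (r := P)).
  rewrite -cmpA u'E cmpBr !cmpA (kermP p).1 cmp0m subr0 aE.
  exact: (uP 0%N).
have [|b [bE _]] := (kermP p).2 _ (a ∘ phi 0%N - u' ∘ rmap P 0).
  by rewrite cmpBr !cmpA aE u'E (uP 0%N) subrr.
exists b; apply: (kernel_mono (kermP p)).
rewrite kcE cmpA bE cmpBl -(cmpA u') (exact_comp0 (rmap_exact P 0)).
by rewrite cmpm0 subr0.
Qed.

(** * Ext as a functor on the stable category *)

Section ExtFunctor.
Variables (C : abelianCat) (E : allowable C) (hE : enough_Eprojectives E).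
Implicit Types (X Y Z M T : C).

Lemma Ext_pre_id n X M (x : Ext hE n X M) : Ext_pre hE n (idmor X) M x = x.
Proof.
rewrite -(cohom_class_repr x) (Ext_preE (lifts_id (res hE X))).
by congr cohom_class; apply: val_inj; exact: cmpm1.
Qed.

Lemma Ext_pre_comp n X Y Z (f : Mor X Y) (g : Mor Y Z) M (x : Ext hE n Z M) :
  Ext_pre hE n (g ∘ f) M x = Ext_pre hE n f M (Ext_pre hE n g M x).
Proof.
have fP := chain_liftP (res hE X) (res hE Y) f.
have gP := chain_liftP (res hE Y) (res hE Z) g.
rewrite -(cohom_class_repr x) (Ext_preE (lifts_comp fP gP)).
rewrite (Ext_preE gP) (Ext_preE fP).
by congr cohom_class; apply: val_inj; exact: cmpA.
Qed.

Lemma Ext_preB n X Y (f g : Mor X Y) M (x : Ext hE n Y M) :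
  Ext_pre hE n (f - g) M x = Ext_pre hE n f M x - Ext_pre hE n g M x.
Proof.
have fP := chain_liftP (res hE X) (res hE Y) f.
have gP := chain_liftP (res hE X) (res hE Y) g.
rewrite -(cohom_class_repr x) (Ext_preE (liftsB fP gP)).
rewrite (Ext_preE gP) (Ext_preE fP) -raddfB.
by congr cohom_class; apply: val_inj; exact: cmpBr.
Qed.

Lemma Ext_pre_through_projective n X Y T (w : Mor X T) (v : Mor T Y) M
    (x : Ext hE n.+1 Y M) :
  Eprojective E T -> Ext_pre hE n.+1 (v ∘ w) M x = 0.
Proof.
move=> Tp.
have [phi phiE phi0] := lifts_through_projective (res hE X) (res hE Y) w v Tp.
rewrite -(cohom_class_repr x) (Ext_preE phiE) -(raddf0 (@cohom_class _ _ _ _ _ _)).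
congr cohom_class; apply: val_inj => /=.
by rewrite /precomp phi0 cmpm0.
Qed.

Lemma Ext_pre_stable n X Y T (f g : Mor X Y) (w : Mor X T) (v : Mor T Y) M
    (x : Ext hE n.+1 Y M) :
  Eprojective E T -> f - g = v ∘ w ->
  Ext_pre hE n.+1 f M x = Ext_pre hE n.+1 g M x.
Proof.
move=> Tp fgE; apply/eqP; rewrite -subr_eq0 -Ext_preB fgE.
by rewrite Ext_pre_through_projective.
Qed.

Lemma Ext1_obstruction B T (p : Mor B T) : Eepi E p ->
  exists xi : Ext hE 1 T (kerob p), forall S (u : Mor S T),
    Ext_pre hE 1 u _ xi = 0 <-> exists u' : Mor S B, p ∘ u' = u.
Proof.
move=> pE; have [c cZ cP] := obstruction_cocycle (res hE T) pE.
exists (cohom_class (Cocycle cZ)) => S u.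
have uP := chain_liftP (res hE S) (res hE T) u.
rewrite (Ext_preE uP) -(raddf0 (@cohom_class _ _ _ _ _ _)) cohom_classP /=.
by rewrite subr0; exact: cP uP.
Qed.

End ExtFunctor.

(** * Splittings *)

(** Insert the decomposition of the identity of Y ⊕ Q between h and g; hence the
    X-to-Y component of an isomorphism is invertible up to maps through the
    complementary summands. *)
Lemma component_retraction (C : abelianCat) (X Y P Q : C)
    (g : Mor (X ⊕ P) (Y ⊕ Q)) (h : Mor (Y ⊕ Q) (X ⊕ P)) :
  h ∘ g = idmor _ ->
  idmor X - (prj1 X P ∘ h ∘ inj1 Y Q) ∘ (prj1 Y Q ∘ g ∘ inj1 X P) =
  (prj1 X P ∘ h ∘ inj2 Y Q) ∘ (prj2 Y Q ∘ g ∘ inj1 X P).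
Proof.
move=> hg; have [X11 _ _ _ _] := biprodP X P.
have [_ _ _ _ Yid] := biprodP Y Q.
have -> : idmor X = prj1 X P ∘ h
    ∘ (inj1 Y Q ∘ prj1 Y Q + inj2 Y Q ∘ prj2 Y Q) ∘ g ∘ inj1 X P.
  by rewrite Yid cmpm1 -(cmpA _ h g) hg cmpm1 X11.
by rewrite cmpDr !cmpDl !cmpA addrC addKr.
Qed.

(** The retraction onto the kernel comes from id - t π, which π kills. *)
Lemma section_kernel_biproduct (C : abelianCat) (S Y : C) (pi : Mor S Y)
    (t : Mor Y S) :
  pi ∘ t = idmor Y ->
  exists r : Mor S (kerob pi), is_biproduct t (kerm pi) pi r.
Proof.
move=> pit; have [|r [rE _]] := (kermP pi).2 _ (idmor S - t ∘ pi).
  by rewrite cmpBr cmpm1 cmpA pit cmp1m subrr.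
have kM := kernel_mono (kermP pi).
exists r; split=> //.
- apply: kM; rewrite cmpA rE cmpBl cmp1m -cmpA (kermP pi).1.
  by rewrite cmpm0 subr0 cmpm1.
- by apply: kM; rewrite cmpA rE cmpBl cmp1m -cmpA pit cmpm1 subrr cmpm0.
- exact: (kermP pi).1.
- by rewrite rE addrC subrK.
Qed.

Lemma biproduct_iso (C : abelianCat) (S Y K : C) (i1 : Mor Y S) (i2 : Mor K S)
    (p1 : Mor S Y) (p2 : Mor S K) :
  is_biproduct i1 i2 p1 p2 -> is_iso (inj1 Y K ∘ p1 + inj2 Y K ∘ p2).
Proof.
case=> [p11 p22 p21 p12 sumS].
have [q11 q22 q21 q12 sumB] := biprodP Y K.
exists (i1 ∘ prj1 Y K + i2 ∘ prj2 Y K); split.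
  rewrite cmpDl !cmpDr -!cmpA !(cmpA (prj1 _ _)) !(cmpA (prj2 _ _)).
  by rewrite q11 q22 q21 q12 !cmp1m !cmp0m !cmpm0 addr0 add0r.
rewrite cmpDl !cmpDr -!cmpA !(cmpA p1) !(cmpA p2).
by rewrite p11 p22 p21 p12 !cmp1m !cmp0m !cmpm0 addr0 add0r.
Qed.

Lemma retract_Eprojective (C : abelianCat) (E : allowable C) (W K : C)
    (w : Mor W K) (s : Mor K W) :
  w ∘ s = idmor K -> Eprojective E W -> Eprojective E K.
Proof.
move=> ws Wp M N g gE h; have [h' h'E] := Wp _ _ g gE (h ∘ w).
by exists (h' ∘ s); rewrite cmpA h'E -cmpA ws cmpm1.
Qed.

(** * Isomorphisms on Ext^1 are stable isomorphisms *)

Section ExtIso.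
Variables (C : abelianCat) (E : allowable C) (hE : enough_Eprojectives E).

Lemma split_iso_natiso n (X Y P Q : C) (g : Mor (X ⊕ P) (Y ⊕ Q)) :
  Eprojective E P -> Eprojective E Q -> is_iso g ->
  is_natiso (ExtT hE n.+1 (prj1 Y Q ∘ g ∘ inj1 X P)).
Proof.
move=> Pp Qp [h [hg gh]].
exists (ExtT hE n.+1 (prj1 X P ∘ h ∘ inj1 Y Q)) => M.
split=> x /=; rewrite -Ext_pre_comp -[RHS]Ext_pre_id; apply/esym.
  exact: Ext_pre_stable Pp (component_retraction gh).
exact: Ext_pre_stable Qp (component_retraction hg).
Qed.

(** As S is X up to an E-projective summand, the class of an E-epimorphism
    w : W -> ker π, with W E-projective, pulls back along r to π^* η for some η.
    The section t detects η while r t = 0, so η = 0; then r k = id, for k the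
    inclusion of ker π, shows that the class itself is 0, so w splits. *)
Lemma section_kernel_Eprojective (X Y P S : C) (pi : Mor S Y) (t : Mor Y S)
    (i1 : Mor X S) (i2 : Mor P S) (p1 : Mor S X) (p2 : Mor S P) :
  is_biproduct i1 i2 p1 p2 -> Eprojective E P -> pi ∘ t = idmor Y ->
  (forall M (y : Ext hE 1 X M), exists eta, Ext_pre hE 1 (pi ∘ i1) M eta = y) ->
  Eprojective E (kerob pi).
Proof.
move=> [_ _ _ _ sumS] Pp pit surj.
have [r [_ rk rt _ _]] := section_kernel_biproduct pit.
have [W [w [Wp wE]]] := hE (kerob pi).
have [xi xiP] := Ext1_obstruction hE wE.
(* Ext^1 of S is carried by its summand X. *)
have onX M (y : Ext hE 1 S M) :
    y = Ext_pre hE 1 p1 M (Ext_pre hE 1 i1 M y).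
  rewrite -Ext_pre_comp -[LHS]Ext_pre_id.
  by apply: (Ext_pre_stable _ Pp (w := p2) (v := i2)); rewrite -sumS addrC addKr.
have [eta etaE] := surj _ (Ext_pre hE 1 i1 _ (Ext_pre hE 1 r _ xi)).
have rxi : Ext_pre hE 1 r _ xi = Ext_pre hE 1 pi _ eta.
  by rewrite [LHS]onX -etaE [RHS]onX -(Ext_pre_comp i1).
have eta0 : eta = 0.
  rewrite -(Ext_pre_id eta) -pit Ext_pre_comp -rxi -Ext_pre_comp rt.
  by rewrite -[0](subrr (r ∘ t)) Ext_preB subrr.
have [|s sE] := (xiP _ (idmor _)).1; last exact: retract_Eprojective sE Wp.
by rewrite -rk Ext_pre_comp rxi eta0 !raddf0.
Qed.

End ExtIso.

Theorem lemma3p7 (C : abelianCat) (E : allowable C)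
    (hS : sectile_epics E) (hE : enough_Eprojectives E)
    (X Y : C) (f : Mor X Y) :
  is_natiso (ExtT hE 1 f) <->
  exists (P Q : C) (g : Mor (X ⊕ P) (Y ⊕ Q)),
    [/\ Eprojective E P, Eprojective E Q, is_iso g
      & prj1 Y Q ∘ g ∘ inj1 X P = f].
Proof.
split=> [[theta thetaK]|[P [Q [g [Pp Qp gI <-]]]]]; last exact: split_iso_natiso.
have [P [q [Pp qE]]] := hE Y.
have SP := biprodP X P; have [i11 i22 i21 i12 _] := SP.
pose pi := f ∘ prj1 X P + q ∘ prj2 X P.
have pi1 : pi ∘ inj1 X P = f by rewrite cmpDl -!cmpA i11 i21 cmpm0 cmpm1 addr0.
have pi2 : pi ∘ inj2 X P = q by rewrite cmpDl -!cmpA i22 i12 cmpm0 cmpm1 add0r.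
have piE : Eepi E pi by apply: (hS _ _ _ pi (inj2 X P)); rewrite pi2.
have [xi xiP] := Ext1_obstruction hE piE.
(* f lifts through π by the first injection, so the class of π dies in
   Ext^1(X, -), hence is 0, and the identity of Y lifts through π. *)
have [t tE] : exists t, pi ∘ t = idmor Y.
  apply/xiP; rewrite Ext_pre_id; apply: (can_inj (thetaK _).1).
  by rewrite raddf0 /=; apply/xiP; exists (inj1 X P).
have Kp : Eprojective E (kerob pi).
  apply: (section_kernel_Eprojective SP Pp tE (hE := hE) _) => M y.
  by rewrite pi1; exists (theta M y); exact: (thetaK M).2.
have [r rP] := section_kernel_biproduct tE.
exists P, (kerob pi), (inj1 Y _ ∘ pi + inj2 Y _ ∘ r); split=> //.
  exact: biproduct_iso rP.
have [q11 _ _ q12 _] := biprodP Y (kerob pi).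
by rewrite cmpDr !cmpA q11 q12 cmp0m cmp1m addr0.
Qed.
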